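(* Let $M\in\mathbb{N}_+$, let $\{(A_i,B_i)\in\mathbb{R}^{n\times n}\times\mathbb{R}^{n\times m} : i\in\langle M\rangle\}$ be given, let $T\in\mathbb{N}$, and consider the switched control system $x(k+1)=A_{\sigma(k)}x(k)+B_{\sigma(k)}u(k)$. (Mod-Ind) Suppose that symmetric positive definite matrices $\bar P_{\hat w}\in\mathbb{R}^{n\times n}$ and matrices $\bar K_{\hat w}\in\mathbb{R}^{m\times n}$, $\hat w\in\mathcal{W}(M,T)$, satisfy $$\begin{bmatrix}\bar P_{\hat w} & \bar P_{\hat w}A_i^\top+\bar K_{\hat w}^\top B_i^\top\\ A_i\bar P_{\hat w}+B_i\bar K_{\hat w} & \bar P_{(\hat w,i)}\end{bmatrix}\succ0\quad\text{for all }\hat w\in\mathcal{W}(M,T-1),\ i\in\langle M\rangle,$$ $$\begin{bmatrix}\bar P_{\hat w} & \bar P_{\hat w}A_i^\top+\bar K_{\hat w}^\top B_i^\top\\ A_i\bar P_{\hat w}+B_i\bar K_{\hat w} & \bar P_{\epsilon}\end{bmatrix}\succ0\quad\text{for all }\hat w\in\langle M\rangle^T,\ i\in\langle M\rangle,$$ and set $K_{\hat w}=\bar K_{\hat w}\bar P_{\hat w}^{-1}$. Then the system is stabilizable via current-mode-independent linear feedbacks with $T$-memory ($T$-SIL$_{\rm m}$), by means of the map $\mathcal{K}$ defined by $$\mathcal{K}(k,[\sigma]_{[0,k-1]})=K_{\mathrm{cut}_{T+1}(\sigma,k)}\qquad\text{for all }\sigma\in\langle M\rangle^\omega,\ k\in\mathbb{N}.$$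 (Mod-Dep) Suppose that symmetric positive definite matrices $\bar P_{\hat w}\in\mathbb{R}^{n\times n}$, $\hat w\in\mathcal{W}(M,T)$, and matrices $\bar K_{\hat w,i}\in\mathbb{R}^{m\times n}$, $\hat w\in\mathcal{W}(M,T)$, $i\in\langle M\rangle$, satisfy $$\begin{bmatrix}\bar P_{\hat w} & \bar P_{\hat w}A_i^\top+\bar K_{\hat w,i}^\top B_i^\top\\ A_i\bar P_{\hat w}+B_i\bar K_{\hat w,i} & \bar P_{(\hat w,i)}\end{bmatrix}\succ0\quad\text{for all }\hat w\in\mathcal{W}(M,T-1),\ i\in\langle M\rangle,$$ $$\begin{bmatrix}\bar P_{\hat w} & \bar P_{\hat w}A_i^\top+\bar K_{\hat w,i}^\top B_i^\top\\ A_i\bar P_{\hat w}+B_i\bar K_{\hat w,i} & \bar P_{\epsilon}\end{bmatrix}\succ0\quad\text{for all }\hat w\in\langle M\rangle^T,\ i\in\langle M\rangle,$$ and set $K_{\hat w,i}=\bar K_{\hat w,i}\bar P_{\hat w}^{-1}$. Then the system is stabilizable via current-mode-dependent linear feedbacks with $T$-memory ($T$-SDL$_{\rm m}$), by means of the map $\mathcal{K}_d$ defined by $$\mathcal{K}_d(k,[\sigma]_{[0,k]})=K_{\mathrm{cut}_{T+1}(\sigma,k),\,\sigma(k)}\qquad\text{for all }\sigma\in\langle M\rangle^\omega,\ k\in\mathbb{N}.$$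
   Context: $\mathbb{N}$ contains $0$; $\mathbb{N}_+=\mathbb{N}\setminus\{0\}$; $\langle M\rangle=\{1,\dots,M\}$; $|\cdot|$ is the Euclidean norm. $\langle M\rangle^k$ is the set of strings of length $k$ over $\langle M\rangle$, with $\langle M\rangle^0=\{\epsilon\}$, $\epsilon$ the empty string; $\langle M\rangle^\star=\bigcup_{k\in\mathbb{N}}\langle M\rangle^k$; $\langle M\rangle^\omega$ is the set of infinite sequences $\sigma:\mathbb{N}\to\langle M\rangle$. $\mathcal{W}(M,T)=\bigcup_{k=0}^{T}\langle M\rangle^k$ (strings of length at most $T$), so that $\mathcal{W}(M,T-1)=\mathcal{W}(M,T)\setminus\langle M\rangle^T$ (empty when $T=0$). For a string $\hat w$ and $i\in\langle M\rangle$, $(\hat w,i)$ is the string obtained by appending $i$ at the end of $\hat w$. For symmetric matrices, $\succ 0$ means positive definite. For $\sigma\in\langle M\rangle^\omega$ and $a\le b$ in $\mathbb{N}$, $[\sigma]_{[a,b]}=(\sigma(a),\sigma(a+1),\dots,\sigma(b))$, and by convention $[\sigma]_{[k,k-1]}=\epsilon$. For an integer $N\geq 1$, $\mathrm{rem}_N(k)$ is the remainder of $k\in\mathbb{N}$ in the division by $N$, and $\mathrm{cut}_N(\sigma,k)=[\sigma]_{[k-\mathrm{rem}_N(k),\,k-1]}$, a string of length $\mathrm{rem}_N(k)\le N-1$. Stabilizability with memory. A map $\mathcal{K}:\mathbb{N}\times\langle M\rangle^\star\to\mathbb{R}^{m\times n}$ is used only at pairs $(k,\hat w)$ where $\hat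 w=[\sigma]_{[0,k-1]}$ (current-mode-independent case) or $\hat w=[\sigma]_{[0,k]}$ (current-mode-dependent case); its other values are irrelevant. The system is stabilizable via current-mode-independent (resp. current-mode-dependent) linear feedbacks with memory, by means of $\mathcal{K}$, if the system $$x(k+1)=\big(A_{\sigma(k)}+B_{\sigma(k)}\mathcal{K}(k,[\sigma]_{[0,k-1]})\big)x(k)\quad\Big(\text{resp. } x(k+1)=\big(A_{\sigma(k)}+B_{\sigma(k)}\mathcal{K}(k,[\sigma]_{[0,k]})\big)x(k)\Big)$$ is uniformly exponentially stable, i.e. there exist $C\ge1$ and $\gamma\in[0,1)$ such that its solution $\phi(\cdot,\sigma,x_0)$ with $\phi(0,\sigma,x_0)=x_0$ satisfies $|\phi(k,\sigma,x_0)|\le C\gamma^k|x_0|$ for all $x_0\in\mathbb{R}^n$, $\sigma\in\langle M\rangle^\omega$, $k\in\mathbb{N}$. It is so with $T$-memory ($T$-SIL$_{\rm m}$, resp. $T$-SDL$_{\rm m}$) if, in addition, for $k\ge T$ the gain depends only on $k$ and on the last switching values from time $k-T$ on: there is a map $\widetilde{\mathcal{K}}$ with $\mathcal{K}(k,[\sigma]_{[0,k-1]})=\widetilde{\mathcal{K}}(k,[\sigma]_{[k-T,k-1]})$ (resp. $\mathcal{K}(k,[\sigma]_{[0,k]})=\widetilde{\mathcal{K}}(k,[\sigma]_{[k-T,k]})$) for all $\sigma\in\langle M\rangle^\omega$ and all $k\ge T$. *)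

(* Defs.v *)
From mathcomp Require Import all_boot all_order all_algebra.
From mathcomp Require Import reals.
Set Implicit Arguments.
Unset Strict Implicit.
Unset Printing Implicit Defensive.
Import Order.TTheory GRing.Theory Num.Theory.
Local Open Scope ring_scope.

(* Modes are 0, ..., M-1 (the type 'I_M) instead of 1, ..., M; strings over
   the modes are [seq 'I_M], and appending i at the end of w is [rcons w i]. *)

Section Words.
Variable M : nat.

(* Half-open convention: [word sigma a b] is (sigma a, ..., sigma (b - 1)),
   and is empty when b <= a. This avoids a truncated k - 1 at k = 0. *)
Definition word (sigma : nat -> 'I_M) (a b : nat) : seq 'I_M :=
  [seq sigma j | j <- index_iota a b].

Definition cut (N : nat) (sigma : nat -> 'I_M) (k : nat) : seq 'I_M :=
  word sigma (k - k %% N)%N k.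

End Words.

Section Matrices.
Variables (R : realType) (n : nat).

(* The norm [`|x|] that the libraries put on matrices is the max norm. *)
Definition eucl_norm (x : 'cV[R]_n) : R := Num.sqrt (\sum_i x i 0 ^+ 2).

Definition posdefmx (P : 'M[R]_n) : Prop :=
  P^T = P /\ forall x : 'cV[R]_n, x != 0 -> 0 < (x^T *m P *m x) 0 0.

End Matrices.

Section Stability.
Variables (R : realType) (M n : nat).

Fixpoint solution (F : nat -> 'M[R]_n) (x0 : 'cV[R]_n) (k : nat) : 'cV[R]_n :=
  if k is k'.+1 then F k' *m solution F x0 k' else x0.

(* [F sigma k] is the matrix of x(k+1) = F sigma k x(k) under the signal sigma;
   C and gamma are uniform in sigma. *)
Definition unif_exp_stable (F : (nat -> 'I_M) -> nat -> 'M[R]_n) : Prop :=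
  exists C gamma : R, [/\ 1 <= C, 0 <= gamma, gamma < 1 &
    forall (x0 : 'cV[R]_n) (sigma : nat -> 'I_M) (k : nat),
      eucl_norm (solution (F sigma) x0 k) <= C * gamma ^+ k * eucl_norm x0].

End Stability.

Section Feedback.
Variables (R : realType) (M n m : nat).
Variables (A : 'I_M -> 'M[R]_n) (B : 'I_M -> 'M[R]_(n, m)).

Definition stabilizing_indep (K : nat -> seq 'I_M -> 'M[R]_(m, n)) : Prop :=
  unif_exp_stable (fun sigma k =>
    A (sigma k) + B (sigma k) *m K k (word sigma 0 k)).

Definition stabilizing_dep (K : nat -> seq 'I_M -> 'M[R]_(m, n)) : Prop :=
  unif_exp_stable (fun sigma k =>
    A (sigma k) + B (sigma k) *m K k (word sigma 0 k.+1)).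

Definition T_SILm (T : nat) (K : nat -> seq 'I_M -> 'M[R]_(m, n)) : Prop :=
  stabilizing_indep K /\
  exists Kt : nat -> seq 'I_M -> 'M[R]_(m, n),
    forall (sigma : nat -> 'I_M) (k : nat), (T <= k)%N ->
      K k (word sigma 0 k) = Kt k (word sigma (k - T) k).

Definition T_SDLm (T : nat) (K : nat -> seq 'I_M -> 'M[R]_(m, n)) : Prop :=
  stabilizing_dep K /\
  exists Kt : nat -> seq 'I_M -> 'M[R]_(m, n),
    forall (sigma : nat -> 'I_M) (k : nat), (T <= k)%N ->
      K k (word sigma 0 k.+1) = Kt k (word sigma (k - T) k.+1).

End Feedback.

Definition lmi_block (R : realType) (n m : nat) (A : 'M[R]_n)
    (B : 'M[R]_(n, m)) (P : 'M[R]_n) (K : 'M[R]_(m, n)) (Pnext : 'M[R]_n) :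
    'M[R]_(n + n) :=
  block_mx P                   (P *m A^T + K^T *m B^T)
           (A *m P + B *m K)   Pnext.

(* Main.v *)
(* V_w(x) = x^T P_w^-1 x is a Lyapunov function along the words w = cut(sigma, k):
   by a Schur complement, each LMI says that V strictly decreases along the
   transition w -> (w, i), or w -> epsilon when |w| = T. There are finitely many
   transitions, so the decrease is by a uniform factor, which gives exponential
   stability. *)

Require Import Defs.
From mathcomp Require Import all_boot all_order all_algebra.
From mathcomp Require Import reals ring lra.
Set Implicit Arguments.
Unset Strict Implicit.
Unset Printing Implicit Defensive.
Import Order.TTheory GRing.Theory Num.Theory.
Local Open Scope ring_scope.

(** * Quadratic forms and positive definite matrices *)

Section QuadraticForms.
Variable R : realType.
Implicit Types n : nat.

Definition qform n (P : 'M[R]_n) (x : 'cV[R]_n) : R := (x^T *m P *m x) 0 0.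

Lemma qformB n (P N : 'M[R]_n) x : qform (P - N) x = qform P x - qform N x.
Proof. by rewrite /qform mulmxBr mulmxBl !mxE. Qed.

Lemma qform_conj n (P F : 'M[R]_n) x :
  qform (F^T *m P *m F) x = qform P (F *m x).
Proof. by rewrite /qform trmx_mul !mulmxA. Qed.

Lemma qform_ge0 n (P : 'M[R]_n) x : posdefmx P -> 0 <= qform P x.
Proof.
case=> _ P_gt0; have [->|x_n0] := eqVneq x 0; last exact/ltW/P_gt0.
by rewrite /qform mulmx0 mxE.
Qed.

Lemma qform1 n (x : 'cV[R]_n) : qform 1%:M x = \sum_i x i 0 ^+ 2.
Proof.
by rewrite /qform mulmx1 mxE; apply: eq_bigr => i _; rewrite mxE expr2.
Qed.

Lemma eucl_norm_sqr n (x : 'cV[R]_n) : eucl_norm x ^+ 2 = qform 1%:M x.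
Proof. by rewrite qform1 sqr_sqrtr // sumr_ge0 // => i _; rewrite sqr_ge0. Qed.

Lemma qform_ub n (N : 'M[R]_n) :
  exists2 c, 0 < c & forall x, qform N x <= c * qform 1%:M x.
Proof.
(* The summand 1 keeps the constant positive even when N = 0. *)
exists (1 + \sum_j \sum_i `|N i j|) => [|x].
  by rewrite ltr_pwDl // sumr_ge0 // => i _; rewrite sumr_ge0.
have coord_le i : x i 0 ^+ 2 <= qform 1%:M x.
  by rewrite qform1 (bigD1 i) //= lerDl sumr_ge0 // => j _; rewrite sqr_ge0.
have nx_ge0 : 0 <= qform 1%:M x.
  by rewrite qform1 sumr_ge0 // => j _; rewrite sqr_ge0.
rewrite mulrDl mul1r ler_wpDl // mulr_suml {1}/qform mxE.
apply: ler_sum => j _; rewrite mulr_suml mxE mulr_suml; apply: ler_sum => i _.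
rewrite mxE mulrAC mulrC.
apply: le_trans (ler_norm _) _; rewrite normrM ler_wpM2l // normrM.
(* Here |x_i| |x_j| <= (x_i^2 + x_j^2) / 2 <= |x|^2. *)
have := coord_le i; have := coord_le j.
rewrite -(real_normK (num_real (x i 0))) -(real_normK (num_real (x j 0))).
have := sqr_ge0 (`|x i 0| - `|x j 0|); nra.
Qed.

Lemma posdef_unitmx n (P : 'M[R]_n) : posdefmx P -> P \in unitmx.
Proof.
case=> _ P_gt0; rewrite unitmxE unitfE; apply/negP => /det0P[v v_n0 vP0].
have := P_gt0 v^T; rewrite trmx_eq0 trmxK vP0 mul0mx mxE ltxx.
by move/(_ v_n0).
Qed.

Lemma posdef_invmx n (P : 'M[R]_n) : posdefmx P -> posdefmx (invmx P).
Proof.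
move=> Ppos; have Pu := posdef_unitmx Ppos; case: Ppos => Psym P_gt0.
have Qsym : (invmx P)^T = invmx P by rewrite trmx_inv Psym.
(* The form of P^-1 at x is the form of P at P^-1 x. *)
split=> // x x_n0; have := P_gt0 (invmx P *m x).
rewrite trmx_mul Qsym !mulmxA mulmxKV //; apply.
by apply: contraNneq x_n0 => Qx0; rewrite -(mulKVmx Pu x) Qx0 mulmx0.
Qed.

(* Evaluate P >= 0 at x - c^-1 P^-1 x, where P^-1 <= c. *)
Lemma posdef_lb n (P : 'M[R]_n) : posdefmx P ->
  exists2 c, 0 < c & forall x, c * qform 1%:M x <= qform P x.
Proof.
move=> Ppos; have Pu := posdef_unitmx Ppos.
have [c c_gt0 Qle] := qform_ub (invmx P).
exists c^-1 => [|x]; first by rewrite invr_gt0.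
have Qsym : (invmx P)^T = invmx P by rewrite trmx_inv (proj1 Ppos).
have := qform_ge0 (x - c^-1 *: (invmx P *m x)) Ppos.
have -> : qform P (x - c^-1 *: (invmx P *m x)) =
    qform P x - c^-1 * qform 1%:M x *+ 2 + c^-1 ^+ 2 * qform (invmx P) x.
  have yT : (x - c^-1 *: (invmx P *m x))^T = x^T - c^-1 *: (x^T *m invmx P).
    by rewrite linearB linearZ /= trmx_mul Qsym.
  rewrite /qform yT mulmx1 mulmxBl mulmxBr !mulmxBl -!scalemxAl -!scalemxAr.
  rewrite !mulmxA mulmxKV // mulmxK //.
  rewrite !mxE; ring.
have := ler_wpM2l (sqr_ge0 c^-1) (Qle x).
have -> : c^-1 ^+ 2 * (c * qform 1%:M x) = c^-1 * qform 1%:M x.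
  by field; rewrite gt_eqF.
lra.
Qed.

(** Both forms are compared with |x|^2: P is at least c and N at most d, whence e = c / d. *)
Lemma posdef_dominates n (P N : 'M[R]_n) : posdefmx P ->
  exists2 e, 0 < e & forall x, e * qform N x <= qform P x.
Proof.
move=> /posdef_lb[c c_gt0 Plb]; have [d d_gt0 Nub] := qform_ub N.
exists (c / d) => [|x]; first by rewrite divr_gt0.
apply: le_trans (Plb x).
by rewrite -mulrA ler_pM2l // mulrC ler_pdivrMr // mulrC.
Qed.

(** The minimum of finitely many constants, capped at 1 so that 1 - e can serve as a contraction
    factor. Lowering a constant to this minimum preserves the bound where the form of [N j] is
    nonnegative. *)
Lemma posdef_dominates_unif (J : finType) n (P N : J -> 'M[R]_n) :
  (forall j, posdefmx (P j)) ->
  exists e, [/\ 0 < e, e <= 1 &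
    forall j x, 0 <= qform (N j) x -> e * qform (N j) x <= qform (P j) x].
Proof.
move=> Ppos.
have [f f_gt0 fP] := fin_all_exists2 (fun j => posdef_dominates (N j) (Ppos j)).
exists (\big[Num.min/1]_j f j); split => [||j x Nx_ge0].
- by rewrite lt_bigmin.
- exact: bigmin_le_id.
- by apply: le_trans (fP j x); rewrite ler_wpM2r // bigmin_le_cond.
Qed.

(* The block form at (P^-1 x, - P'^-1 F x) is x^T P^-1 x - (F x)^T P'^-1 F x. *)
Lemma lmi_block_decrease n m (A : 'M[R]_n) (B : 'M[R]_(n, m))
    (P P' : 'M[R]_n) (K : 'M[R]_(m, n)) (F := A + B *m (K *m invmx P)) :
  posdefmx P -> posdefmx P' -> posdefmx (lmi_block A B P K P') ->
  posdefmx (invmx P - F^T *m invmx P' *m F).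
Proof.
move=> Ppos P'pos [_ L_gt0].
have Pu := posdef_unitmx Ppos; have P'u := posdef_unitmx P'pos.
have Psym := proj1 Ppos.
have Qsym := proj1 (posdef_invmx Ppos); have Q'sym := proj1 (posdef_invmx P'pos).
split=> [|x x_n0]; first by rewrite linearB /= !trmx_mul trmxK Qsym Q'sym mulmxA.
set u := invmx P *m x; set v := - (invmx P' *m (F *m x)).
have u_n0 : u != 0.
  by apply: contraNneq x_n0 => u0; rewrite -(mulKVmx Pu x) -/u u0 mulmx0.
have z_n0 : col_mx u v != 0.
  by apply: contraNneq u_n0 => z0; rewrite -(col_mxKu u v) z0 linear0.
have Su : (A *m P + B *m K) *m u = F *m x.
  by rewrite /u /F !mulmxA mulmxDl mulmxK // !mulmxA.
have vP' : v^T *m P' = - (F *m x)^T.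
  by rewrite /v linearN /= trmx_mul Q'sym mulNmx mulmxKV.
have ST : P *m A^T + K^T *m B^T = (A *m P + B *m K)^T.
  by rewrite linearD /= !trmx_mul Psym.
have := L_gt0 _ z_n0.
rewrite /lmi_block tr_col_mx mul_row_block mul_row_col ST.
(* With S = A P + B K, the row multiplying v is (S u)^T + v^T P' = (F x)^T - (F x)^T = 0; what
   remains is u^T P u + v^T F x. *)
rewrite !mulmxDl -(mulmxA v^T _ u) Su -trmx_mul Su vP'.
rewrite mulNmx subrr addr0 /u trmx_mul Qsym mulmxKV // mulmxA.
rewrite /v linearN /= trmx_mul Q'sym mulNmx.
by rewrite mulmxBr mulmxBl trmx_mul !mulmxA.
Qed.

End QuadraticForms.

(** * Lyapunov functions indexed by the states of a finite automaton *)

(* Finiteness of the state space [I] makes the constants uniform in the signal. *)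
Lemma automaton_lyapunov_stable (R : realType) (M n : nat) (I : finType)
    (s0 : I) (next : I -> 'I_M -> I) (st : (nat -> 'I_M) -> nat -> I)
    (G : I -> 'I_M -> 'M[R]_n) (Q : I -> 'M[R]_n)
    (F : (nat -> 'I_M) -> nat -> 'M[R]_n) :
  (forall sigma, st sigma 0 = s0) ->
  (forall sigma k, st sigma k.+1 = next (st sigma k) (sigma k)) ->
  (forall sigma k, F sigma k = G (st sigma k) (sigma k)) ->
  (forall s, posdefmx (Q s)) ->
  (forall s i, posdefmx (Q s - (G s i)^T *m Q (next s i) *m G s i)) ->
  unif_exp_stable F.
Proof.
move=> st0 stS FE Qpos decr.
(* Each transition decreases V by at least e V, hence contracts it by 1 - e. *)
have [e [e_gt0 e_le1 eP]] := posdef_dominates_unif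
  (fun p : I * 'I_M => Q p.1) (fun p => decr p.1 p.2).
(* The lower bound c |x|^2 <= V must hold in every state, the upper bound d only in [s0], where all
   runs start. *)
have [c [c_gt0 _ cP]] := posdef_dominates_unif (fun=> 1%:M) Qpos.
have [d d_gt0 dP] := qform_ub (Q s0).
have nx_ge0 (x : 'cV[R]_n) : 0 <= qform 1%:M x.
  by rewrite -eucl_norm_sqr sqr_ge0.
have V_le sigma k x0 : qform (Q (st sigma k)) (solution (F sigma) x0 k) <=
    (1 - e) ^+ k * qform (Q s0) x0.
  elim: k => [|k IHk]; first by rewrite st0 expr0 mul1r.
  rewrite stS /= FE exprS -mulrA.
  apply: le_trans (ler_wpM2l _ IHk); last by rewrite subr_ge0.
  set x := solution _ _ _.
  have := eP (st sigma k, sigma k) x (qform_ge0 _ (Qpos _)).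
  rewrite qformB qform_conj /=; lra.
have norm_ge0 (x : 'cV[R]_n) : 0 <= eucl_norm x by apply: sqrtr_ge0.
(* The squared norm at time k is at most (d / c) (1 - e)^k |x0|^2; adding 1 to d / c ensures C >=
   1. *)
exists (Num.sqrt (1 + d / c)), (Num.sqrt (1 - e)).
have dc_gt0 : 0 < d / c by rewrite divr_gt0.
split; first by rewrite -[leLHS]sqrtr1 ler_wsqrtr // lerDl ltW.
- exact: sqrtr_ge0.
- by rewrite -[ltRHS]sqrtr1 ltr_sqrt // ltrBlDr ltrDl.
move=> x0 sigma k.
rewrite -ler_sqr ?nnegrE ?mulr_ge0 ?exprn_ge0 ?sqrtr_ge0 //.
rewrite !exprMn !eucl_norm_sqr exprAC !sqr_sqrtr ?subr_ge0 //; last by lra.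
have pow_ge0 : 0 <= (1 - e) ^+ k by rewrite exprn_ge0 // subr_ge0.
have lb := le_trans (cP (st sigma k) _ (nx_ge0 _)) (V_le sigma k x0).
have := le_trans lb (ler_wpM2l pow_ge0 (dP x0)).
rewrite mulrC -ler_pdivlMr // => /le_trans; apply.
rewrite -subr_ge0.
have -> : (1 + d / c) * (1 - e) ^+ k * qform 1%:M x0 -
    (1 - e) ^+ k * (d * qform 1%:M x0) / c = (1 - e) ^+ k * qform 1%:M x0.
  by field; rewrite gt_eqF.
by rewrite mulr_ge0.
Qed.

(** * Words and cuts of a switching signal *)

Section Words.
Variables (M : nat) (sigma : nat -> 'I_M).

Lemma size_word a b : size (word sigma a b) = (b - a)%N.
Proof. by rewrite size_map size_iota. Qed.

Lemma wordS a b : (a <= b)%N ->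
  word sigma a b.+1 = rcons (word sigma a b) (sigma b).
Proof.
move=> le_ab; rewrite /word /index_iota subSn // -addn1 iotaD map_cat subnKC //.
by rewrite cats1.
Qed.

Lemma drop_word j a b : drop j (word sigma a b) = word sigma (a + j) b.
Proof. by rewrite /word -map_drop /index_iota drop_iota subnDA addnC. Qed.

Lemma size_cut T k : (size (cut T.+1 sigma k) <= T)%N.
Proof. by rewrite size_word subKn ?leq_mod // -ltnS ltn_mod. Qed.

(** The cut has length k mod (T+1), which is T exactly when T+1 divides k+1; the cut then restarts.
    Otherwise its starting time is unchanged and one letter is added. *)
Lemma cutS T k : cut T.+1 sigma k.+1 =
  if (size (cut T.+1 sigma k) < T)%N then rcons (cut T.+1 sigma k) (sigma k)
  else [::].
Proof.
rewrite size_word subKn ?leq_mod // /cut modnS.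
have r_le : (k %% T.+1 <= T)%N by rewrite -ltnS ltn_mod.
have -> : (T.+1 %| k.+1)%N = (k %% T.+1 == T)%N.
  rewrite /dvdn -addn1 -modnDml addn1.
  have [->|neq] := eqVneq (k %% T.+1)%N T; first by rewrite modnn.
  by rewrite modn_small // ltnS ltn_neqAle neq.
rewrite ltn_neqAle r_le andbT.
case: eqP => _ /=; first by rewrite subn0 /word /index_iota subnn.
by rewrite subSS wordS // leq_subr.
Qed.

(** Lets the gain be read off any window that starts no later than the cut. *)
Lemma drop_cut N a k : (a <= k - k %% N)%N ->
  drop (k - k %% N - a) (word sigma a k) = cut N sigma k.
Proof. by move=> le_a; rewrite drop_word subnKC. Qed.

End Words.

(** * Stability and memory of the cut feedback *)

(** Serves both cases: without dependence on the current mode, [Kbar] is constant in its second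
    argument. *)
Lemma cut_feedback_stable (R : realType) (M n m T : nat)
    (A : 'I_M -> 'M[R]_n) (B : 'I_M -> 'M[R]_(n, m)) (P : seq 'I_M -> 'M[R]_n)
    (Kbar : seq 'I_M -> 'I_M -> 'M[R]_(m, n))
    (F : (nat -> 'I_M) -> nat -> 'M[R]_n) :
  (forall w, (size w <= T)%N -> posdefmx (P w)) ->
  (forall w i, (size w < T)%N ->
    posdefmx (lmi_block (A i) (B i) (P w) (Kbar w i) (P (rcons w i)))) ->
  (forall w i, size w = T ->
    posdefmx (lmi_block (A i) (B i) (P w) (Kbar w i) (P [::]))) ->
  (forall sigma k, let w := cut T.+1 sigma k in
    F sigma k =
      A (sigma k) + B (sigma k) *m (Kbar w (sigma k) *m invmx (P w))) ->
  unif_exp_stable F.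
Proof.
move=> Ppos lmi_lt lmi_eq FE.
(* The automaton state is the cut itself, in the finite type of words of length at most T. *)
pose st sigma k : {bseq T of 'I_M} := Bseq (size_cut sigma T k).
(* [insub_bseq] resets to the empty word once the length exceeds [T]. *)
pose next (w : {bseq T of 'I_M}) i := insub_bseq T (rcons w i).
have nextE w i :
    next w i = (if (size w < T)%N then rcons w i else [::]) :> seq 'I_M.
  by rewrite [LHS]val_insubd size_rcons.
pose G (w : {bseq T of 'I_M}) i := A i + B i *m (Kbar w i *m invmx (P w)).
apply: (automaton_lyapunov_stable (s0 := [bseq] : {bseq T of 'I_M})
    (next := next) (st := st) (G := G) (Q := fun w => invmx (P w)))
  => [sigma|sigma k|sigma k|w|w i].
- by apply: val_inj; rewrite /= /cut mod0n.
- by apply: val_inj; rewrite [RHS]nextE /= cutS.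
- exact: FE.
- exact/posdef_invmx/Ppos/size_bseq.
have w_le := size_bseq w.
apply: lmi_block_decrease; [exact: Ppos|exact/Ppos/size_bseq|].
rewrite nextE; case: ltnP => w_size; first exact: lmi_lt.
by apply: lmi_eq; apply/eqP; rewrite eqn_leq w_le.
Qed.

Theorem proposition3 (R : realType) (M : nat) (hM : (0 < M)%N) (n m : nat)
    (A : 'I_M -> 'M[R]_n) (B : 'I_M -> 'M[R]_(n, m)) (T : nat) :
  (forall (P : seq 'I_M -> 'M[R]_n) (Kbar : seq 'I_M -> 'M[R]_(m, n)),
    (forall w : seq 'I_M, (size w <= T)%N -> posdefmx (P w)) ->
    (forall (w : seq 'I_M) (i : 'I_M), (size w < T)%N ->
      posdefmx (lmi_block (A i) (B i) (P w) (Kbar w) (P (rcons w i)))) ->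
    (forall (w : seq 'I_M) (i : 'I_M), size w = T ->
      posdefmx (lmi_block (A i) (B i) (P w) (Kbar w) (P [::]))) ->
    let K := fun w : seq 'I_M => Kbar w *m invmx (P w) in
    let defines := fun calK : nat -> seq 'I_M -> 'M[R]_(m, n) =>
      forall (sigma : nat -> 'I_M) (k : nat),
        calK k (word sigma 0 k) = K (cut T.+1 sigma k) in
    (exists calK, defines calK) /\
    (forall calK, defines calK -> T_SILm A B T calK))
  /\
  (forall (P : seq 'I_M -> 'M[R]_n) (Kbar : seq 'I_M -> 'I_M -> 'M[R]_(m, n)),
    (forall w : seq 'I_M, (size w <= T)%N -> posdefmx (P w)) ->
    (forall (w : seq 'I_M) (i : 'I_M), (size w < T)%N ->
      posdefmx (lmi_block (A i) (B i) (P w) (Kbar w i) (P (rcons w i)))) ->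
    (forall (w : seq 'I_M) (i : 'I_M), size w = T ->
      posdefmx (lmi_block (A i) (B i) (P w) (Kbar w i) (P [::]))) ->
    let K := fun (w : seq 'I_M) (i : 'I_M) => Kbar w i *m invmx (P w) in
    let defines := fun calK : nat -> seq 'I_M -> 'M[R]_(m, n) =>
      forall (sigma : nat -> 'I_M) (k : nat),
        calK k (word sigma 0 k.+1) = K (cut T.+1 sigma k) (sigma k) in
    (exists calK, defines calK) /\
    (forall calK, defines calK -> T_SDLm A B T calK)).
Proof.
(* The cut lies within the last T switching values, which gives T-memory. *)
have window k : (k - T <= k - k %% T.+1)%N.
  by rewrite leq_sub2l // -ltnS ltn_mod.
split=> [P Kbar Ppos lmi_lt lmi_eq K defines|P Kbar Ppos lmi_lt lmi_eq K defines].
  split=> [|calK calKE].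
    exists (fun k w => K (drop (k - k %% T.+1) w)) => sigma k.
    by rewrite drop_word.
  split.
    apply: (cut_feedback_stable (Kbar := fun w _ => Kbar w) Ppos lmi_lt lmi_eq).
    by move=> sigma k w; rewrite calKE.
  exists (fun k w => K (drop (k - k %% T.+1 - (k - T)) w)) => sigma k le_Tk.
  by rewrite calKE drop_cut.
(* Default for [last], never returned on the nonempty words used below. *)
pose i0 := Ordinal hM.
(* The last letter is the current mode; the other letters, with the first d dropped, form the
   cut. *)
pose gain d w := K (drop d (rev (behead (rev w)))) (last i0 w).
have gainE d a sigma k : (a <= k)%N ->
    gain d (word sigma a k.+1) = K (word sigma (a + d) k) (sigma k).
  by move=> le_ak; rewrite /gain wordS // last_rcons rev_rcons /= revK
    drop_word.
split=> [|calK calKE].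
  by exists (fun k => gain (k - k %% T.+1)%N) => sigma k; rewrite gainE.
split.
  apply: (cut_feedback_stable Ppos lmi_lt lmi_eq).
  by move=> sigma k w; rewrite calKE.
exists (fun k => gain (k - k %% T.+1 - (k - T))%N) => sigma k le_Tk.
by rewrite calKE gainE ?leq_subr // subnKC.
Qed.
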